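(* Let $m$ be a positive integer, $r$ a nonnegative integer, $\lambda\in\mathbb{R}$. For integers $n\ge k\ge0$, $$W_{m,\lambda}^{(r+1)}(n,k)=\sum_{l=k}^{n}\binom{n}{l}(1)_{n-l,\lambda}W_{m,\lambda}^{(r)}(l,k).$$
   Context: $(x)_{0,\lambda}=1$, $(x)_{n,\lambda}=x(x-\lambda)\cdots(x-(n-1)\lambda)$, $(x)_n=(x)_{n,1}$. For a nonnegative integer $s$, the degenerate $s$-Whitney numbers of the second kind are defined by the polynomial identities $(mx+s)_{n,\lambda}=\sum_{k=0}^n W_{m,\lambda}^{(s)}(n,k)m^k(x)_k$. *)

(* Defs.v *)
From HB Require Import structures.
From mathcomp Require Import all_boot all_order all_algebra.
From mathcomp Require Import boolp classical_sets reals.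
From mathcomp Require Import ring.

Set Implicit Arguments.
Unset Strict Implicit.
Unset Printing Implicit Defensive.

Import Order.TTheory GRing.Theory Num.Theory.
Local Open Scope ring_scope.

(* (x)_{n,lam} = x (x - lam) ... (x - (n-1) lam); the ring is arbitrary because
   it is used both on real numbers and on polynomials. *)
Definition degfall (A : comPzRingType) (lam x : A) (n : nat) : A :=
  \prod_(i < n) (x - i%:R * lam).

(* Identities in {poly R}, so x is an indeterminate. Only the values W n k with
   k <= n are constrained. *)
Definition is_whitney2 (R : realType) (m : nat) (lam : R) (s : nat)
    (W : nat -> nat -> R) : Prop :=
  forall n : nat,
    degfall lam%:P (m%:R * 'X + s%:R) n =
    \sum_(0 <= k < n.+1) (W n k * m%:R ^+ k) *: degfall 1 ('X : {poly R}) k.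

(* [whitney2 m lam s n k] is W_{m,lam}^{(s)}(n,k): a family satisfying the
   defining identities. One exists by [whitney2P]; for m > 0 its values at
   k <= n are unique by [whitney2_uniq]. *)
Definition whitney2 (R : realType) (m : nat) (lam : R) (s : nat) :
    nat -> nat -> R :=
  xget (fun _ _ => 0) [set W | is_whitney2 m lam s W]%classic.

Lemma degfallS (A : comPzRingType) (lam x : A) (n : nat) :
  degfall lam x n.+1 = degfall lam x n * (x - n%:R * lam).
Proof. by rewrite /degfall big_ord_recr. Qed.

Fixpoint whitney2_rec (R : realType) (m : nat) (lam : R) (s n k : nat) : R :=
  if n is n'.+1 then
    (if k is k'.+1 then whitney2_rec m lam s n' k' else 0)
    + (m%:R * k%:R + s%:R - n'%:R * lam) * whitney2_rec m lam s n' k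
  else (k == 0)%:R.

Lemma whitney2_rec_gt (R : realType) (m : nat) (lam : R) (s n k : nat) :
  (n < k)%N -> whitney2_rec m lam s n k = 0.
Proof.
elim: n k => [|n IH] [|k] //= nk.
by rewrite !IH ?mulr0 ?addr0 // ltnW.
Qed.

Lemma whitney2_recP (R : realType) (m : nat) (lam : R) (s : nat) :
  is_whitney2 m lam s (whitney2_rec m lam s).
Proof.
elim=> [|n IH].
  by rewrite big_nat1 /degfall !big_ord0 /= expr0 mulr1 scale1r.
rewrite degfallS IH mulr_suml.
under [RHS]eq_bigr do rewrite /= mulrDl scalerDl.
rewrite big_split /= [X in _ = X + _]big_nat_recl //= mul0r scale0r add0r.
rewrite [X in _ = _ + X]big_nat_recr //= whitney2_rec_gt // mulr0 mul0r.
rewrite scale0r addr0 -big_split; apply: eq_bigr => k _ /=.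
rewrite degfallS -!mul_polyC !(polyCM, polyCD, polyCN, polyC_exp, polyC_natr).
by rewrite exprS; ring.
Qed.

Lemma whitney2P (R : realType) (m : nat) (lam : R) (s : nat) :
  is_whitney2 m lam s (whitney2 m lam s).
Proof.
exact: (@xgetPex _ _ _ (ex_intro _ _ (whitney2_recP m lam s))).
Qed.

Lemma degfall_free (R : realType) (n : nat) (c : nat -> R) :
  \sum_(0 <= k < n) c k *: degfall 1 ('X : {poly R}) k = 0 ->
  forall k, (k < n)%N -> c k = 0.
Proof.
have lead j : size (degfall 1 ('X : {poly R}) j) = j.+1.
  elim: j => [|j IH]; first by rewrite /degfall big_ord0 size_poly1.
  rewrite degfallS mulr1 -polyC_natr size_Mmonic ?monicXsubC //; last first.
    by rewrite -size_poly_eq0 IH.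
  by rewrite IH size_XsubC addn2.
elim: n => [|n IH] // h.
have cn : c n = 0.
  apply/eqP; apply: contraT => cn0.
  move: h; rewrite big_nat_recr //= addrC => /(congr1 (size \o @polyseq R)) /=.
  rewrite size_polyDl ?size_poly0 ?size_scale ?lead //.
  apply: (leq_ltn_trans (n := n)) => //.
  rewrite big_seq; apply: (leq_trans (size_sum _ _ _)).
  apply/bigmax_leqP_seq => i; rewrite mem_index_iota => /andP[_ ilt] _.
  by apply: (leq_trans (size_scale_leq _ _)); rewrite lead.
move: h; rewrite big_nat_recr //= cn scale0r addr0 => h k.
by rewrite ltnS leq_eqVlt => /predU1P[-> // | /(IH h)].
Qed.

Lemma whitney2_uniq (R : realType) (m : nat) (lam : R) (s : nat)
    (W W' : nat -> nat -> R) :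
  (0 < m)%N -> is_whitney2 m lam s W -> is_whitney2 m lam s W' ->
  forall n k : nat, (k <= n)%N -> W n k = W' n k.
Proof.
move=> m0 h h' n k kn.
have /degfall_free/(_ k kn) : \sum_(0 <= k < n.+1)
    ((W n k - W' n k) * m%:R ^+ k) *: degfall 1 ('X : {poly R}) k = 0.
  under eq_bigr do rewrite mulrBl scalerBl.
  by rewrite sumrB -h -h' subrr.
move/eqP; rewrite mulf_eq0 expf_eq0 pnatr_eq0 -(negbK (m == 0)%N) -lt0n m0 /=.
by rewrite andbF orbF subr_eq0 => /eqP.
Qed.

(* Main.v *)
(* Since (x)_{n,lam} is of binomial type, (m x + r + 1)_{n,lam} is the binomial
   convolution of (1)_{n,lam} and (m x + r)_{n,lam}. Expanding the latter in the
   falling factorials (x)_k shows that the right-hand side satisfies the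
   identities defining the numbers with parameter r + 1, and these determine it. *)
Require Import Defs.
From mathcomp Require Import all_boot all_order all_algebra.
From mathcomp Require Import reals.
From mathcomp Require Import ring.
Import GRing.Theory.
Local Open Scope ring_scope.

Lemma degfall0 (A : comPzRingType) (lam x : A) : degfall lam x 0 = 1.
Proof. by rewrite /degfall big_ord0. Qed.

Lemma rmorph_degfall (A B : comPzRingType) (f : {rmorphism A -> B})
    (lam x : A) (n : nat) :
  f (degfall lam x n) = degfall (f lam) (f x) n.
Proof.
rewrite /degfall rmorph_prod; apply: eq_bigr => i _.
by rewrite rmorphB rmorphM rmorph_nat.
Qed.

(** Induction on [n]: against the [l]-th term, the new factor [x + y - n lam] splits as
    [(x - (n - l) lam) + (y - l lam)], and each part extends one of the two products. Pascal's rule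
    then recombines the two sums. *)
Lemma degfallD (A : comPzRingType) (lam x y : A) (n : nat) :
  degfall lam (x + y) n =
  \sum_(0 <= l < n.+1)
     'C(n, l)%:R * degfall lam x (n - l) * degfall lam y l.
Proof.
elim: n => [|n IH].
  by rewrite big_nat1 bin0 !degfall0 !mulr1.
have split_factor l : (0 <= l < n.+1)%N ->
    'C(n, l)%:R * degfall lam x (n - l) * degfall lam y l
      * (x + y - n%:R * lam) =
    'C(n, l)%:R * degfall lam x (n - l) * degfall lam y l.+1
    + 'C(n, l)%:R * degfall lam x (n.+1 - l) * degfall lam y l.
  rewrite ltnS => /= ln; rewrite subSn // !degfallS.
  have -> : n%:R = (n - l)%:R + l%:R :> A by rewrite -natrD subnK.
  by move: (degfall _ _ _) (degfall _ _ _) => u v; ring.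
rewrite degfallS IH mulr_suml (eq_big_nat _ _ split_factor) big_split /=.
(* The terms at [l = 0] agree; the others are shifted to [l.+1] to apply Pascal's rule. *)
rewrite [X in _ + X]big_nat_recl // [RHS]big_nat_recl //= !bin0 addrCA.
congr (_ + _); under [RHS]eq_bigr do rewrite binS natrD !mulrDl subSS.
(* The surplus top term carries ['C(n, n.+1) = 0]. *)
rewrite big_split /= addrC [X in _ = X + _]big_nat_recr //= bin_small //.
rewrite !mul0r addr0.
by congr (_ + _); apply: eq_bigr => l _; rewrite subSS.
Qed.

Lemma is_whitney2_binomial_convolution (R : realType) (m : nat) (lam : R)
    (r : nat) (W : nat -> nat -> R) :
  is_whitney2 m lam r W ->
  is_whitney2 m lam r.+1 (fun n k =>
    \sum_(k <= l < n.+1) 'C(n, l)%:R * degfall lam 1 (n - l) * W l k).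
Proof.
move=> WP n.
have -> : m%:R * 'X + r.+1%:R = 1 + (m%:R * 'X + r%:R) :> {poly R}.
  by rewrite -natr1; ring.
rewrite degfallD.
pose F (l k : nat) : {poly R} :=
  ('C(n, l)%:R * degfall lam 1 (n - l) * W l k * m%:R ^+ k) *: degfall 1 'X k.
(* The triangle [k <= l <= n] is written as a square with a condition, so that the two sums can be
   exchanged. *)
transitivity (\sum_(0 <= l < n.+1) \sum_(0 <= k < n.+1 | (k <= l)%N) F l k).
  apply: eq_big_nat => l /andP[_ ln].
  (* The factor at [1] is a constant polynomial, so it becomes a scalar and joins the
     coefficient. *)
  rewrite WP -polyC1 -(rmorph_degfall _ _ polyC).
  rewrite -polyC_natr -polyCM mul_polyC scaler_sumr.
  rewrite (big_nat_widen _ _ n.+1) //.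
  by apply: eq_bigr => k _; rewrite scalerA /F !mulrA.
rewrite (exchange_big_dep_nat xpredT) //=.
apply: eq_big_nat => k /andP[_ kn].
by rewrite mulr_suml scaler_suml [RHS](big_nat_widenl _ 0%N).
Qed.

Theorem theorem10 (R : realType) (m r : nat) (lam : R) (hm : (0 < m)%N)
    (n k : nat) (hkn : (k <= n)%N) :
  whitney2 m lam r.+1 n k =
  \sum_(k <= l < n.+1)
     'C(n, l)%:R * degfall lam 1 (n - l) * whitney2 m lam r l k.
Proof.
exact: (whitney2_uniq hm (whitney2P m lam r.+1)
  (is_whitney2_binomial_convolution _ _ _ _ _ (whitney2P m lam r))).
Qed.
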